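(* Let $(I_n)_{n\in\mathbb{N}}$ be any $\operatorname{Sym}$-invariant chain of squarefree monomial ideals $I_n\subseteq R_n$. Then the number of $\operatorname{Sym}(n)$-orbits of primary components of $I_n$ grows polynomially in $n$ eventually; that is, it agrees with a polynomial in $n$ for all sufficiently large $n$.
   Context: $\mathbb{N}$ denotes the positive integers. Fix $c\in\mathbb{N}$ and a field $\mathbf{k}$. For $n\in\mathbb{N}$ let $R_n=\mathbf{k}[x_{i,j}\mid i\in[c],\ j\in[n]]$, so $R_m\subseteq R_n$ for $m\le n$. The symmetric group $\operatorname{Sym}(n)$ acts on $R_n$ by $\sigma\cdot x_{i,j}=x_{i,\sigma(j)}$. A $\operatorname{Sym}$-invariant chain is a sequence $(I_n)_{n\in\mathbb{N}}$ of ideals $I_n\subseteq R_n$ with $\sigma(f)\in I_n$ for all $m\le n$, $f\in I_m$, $\sigma\in\operatorname{Sym}(n)$. Since $I_n$ is a squarefree monomial ideal, its primary components are its associated (equivalently minimal) primes, on which $\operatorname{Sym}(n)$ acts. *)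

(* Defs.v *)
From HB Require Import structures.
From mathcomp Require Import all_boot all_order all_fingroup all_algebra.
From mathcomp Require Import mathcomp_extra boolp classical_sets functions cardinality.
From mathcomp Require Import mpoly.

Set Implicit Arguments.
Unset Strict Implicit.
Unset Printing Implicit Defensive.

Import Order.TTheory GRing.Theory Num.Theory.

Local Open Scope classical_set_scope.
Local Open Scope card_scope.
Local Open Scope ring_scope.

(* ring_quotient's idealr_closed only covers proper ideals (it requires
   1 \notin S); here the unit ideal has to be allowed. *)
Definition is_ideal (R : comNzRingType) (I : set R) : Prop :=
  [/\ I 0, (forall x y, I x -> I y -> I (x + y)) & (forall a x, I x -> I (a * x))].

Definition ideal_span (R : comNzRingType) (G : set R) : set R :=
  smallest (@is_ideal R) G.

Definition radical (R : comNzRingType) (I : set R) : set R :=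
  [set x | exists e : nat, I (x ^+ e)].

Definition primary_ideal (R : comNzRingType) (Q : set R) : Prop :=
  [/\ is_ideal Q, ~ Q 1 & forall x y, Q (x * y) -> Q x \/ radical Q y].

(* The empty family is the decomposition of the unit ideal. *)
Definition minimal_primary_decomposition (R : comNzRingType)
    (I : set R) (Qs : set (set R)) : Prop :=
  [/\ finite_set Qs,
      (forall Q, Qs Q -> primary_ideal Q),
      I = \bigcap_(Q in Qs) Q,
      set_inj Qs (@radical R)
    & forall Q, Qs Q -> \bigcap_(Q' in Qs `\ Q) Q' <> I].

(* For a general ideal, embedded components depend on the decomposition; this
   is the set of all ideals occurring in some minimal decomposition. A
   squarefree monomial ideal has exactly one minimal decomposition. *)
Definition primary_components (R : comNzRingType) (I : set R) : set (set R) :=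
  [set Q | exists2 Qs, minimal_primary_decomposition I Qs & Qs Q].

(* R_n = k[x_(i,j) | i in [c], j in [n]], with x_(i,j) stored at position
   mxvec_index i j; indices are 0-based. *)
Definition Rn (c : nat) (k : fieldType) (n : nat) : comNzRingType :=
  {mpoly k[c * n]}.

Definition xvar (c : nat) (k : fieldType) (n : nat) (i : 'I_c) (j : 'I_n) :
    Rn c k n :=
  'X_(mxvec_index i j).

(* The inverse of mxvec_index. *)
Definition var_index (c n : nat) (v : 'I_(c * n)) : 'I_c * 'I_n :=
  enum_val (cast_ord (esym (mxvec_cast c n)) v).

(* The k-algebra morphism R_m -> R_n with x_(i,j) |-> x_(i, phi j). *)
Definition rename (c : nat) (k : fieldType) (m n : nat) (phi : 'I_m -> 'I_n)
    (f : Rn c k m) : Rn c k n :=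
  comp_mpoly
    [tuple xvar k (var_index v).1 (phi (var_index v).2) | v < c * m] f.

Lemma rename_xvar (c : nat) (k : fieldType) (m n : nat) (phi : 'I_m -> 'I_n)
    (i : 'I_c) (j : 'I_m) :
  rename phi (xvar k i j) = xvar k i (phi j).
Proof.
rewrite /rename /xvar comp_mpolyXU -tnth_nth tnth_mktuple /var_index.
by rewrite /mxvec_index cast_ordK enum_rankK.
Qed.

Definition incl (c : nat) (k : fieldType) (m n : nat) (le_mn : (m <= n)%N) :
    Rn c k m -> Rn c k n :=
  rename (widen_ord le_mn).

Definition sym_act (c : nat) (k : fieldType) (n : nat) (s : 'S_n) :
    Rn c k n -> Rn c k n :=
  rename s.

Definition squarefree_monomial_ideal (c : nat) (k : fieldType) (n : nat)
    (I : set (Rn c k n)) : Prop :=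
  exists S : set 'X_{1..c * n},
    (forall a, S a -> forall v, (a v <= 1)%N) /\
    I = ideal_span [set ('X_[a] : Rn c k n) | a in S].

(* Only the members with index n > 0 matter; I 0 is unconstrained. *)
Definition sym_invariant_chain (c : nat) (k : fieldType)
    (I : forall n, set (Rn c k n)) : Prop :=
  (forall n, (0 < n)%N -> is_ideal (I n)) /\
  (forall m n (le_mn : (m <= n)%N), (0 < m)%N ->
     forall (f : Rn c k m) (s : 'S_n),
       I m f -> I n (sym_act s (incl le_mn f))).

Definition sym_orbit (c : nat) (k : fieldType) (n : nat)
    (Q : set (Rn c k n)) : set (set (Rn c k n)) :=
  [set sym_act s @` Q | s in [set: 'S_n]].

Definition component_orbits (c : nat) (k : fieldType) (n : nat)
    (I : set (Rn c k n)) : set (set (set (Rn c k n))) :=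
  [set sym_orbit Q | Q in primary_components I].

(* Main.v *)
(** A squarefree monomial ideal I is the intersection of the primes P_F
generated by the variables outside F, where F runs over the facets of its
Stanley-Reisner complex, and these primes are its primary components.  Reading
a set F of variables column by column, its Sym(n)-orbit is recorded by the
vector m in N^(2^c) counting how often each subset of [c] occurs as a column,
and |m| = n.  Invariance of the chain says that the vectors of nonfaces, for
all n together, form an up-set of N^(2^c), so by Dickson's lemma membership
depends only on the coordinates truncated at some constant K.  F is a facet when
m is not in the up-set but becomes so whenever a column is enlarged by one
element; this too depends only on truncated coordinates, and the number of
vectors of sum n in a set determined by truncated coordinates is eventually
polynomial in n. *)

Require Import Defs.
From HB Require Import structures.
From mathcomp Require Import all_boot all_order all_fingroup all_algebra.
From mathcomp Require Import mathcomp_extra boolp classical_sets functions cardinality.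
From mathcomp Require Import mpoly.
From mathcomp Require Import zify ring.

Import Order.TTheory GRing.Theory Num.Theory.

Local Open Scope classical_set_scope.
Local Open Scope card_scope.
Local Open Scope ring_scope.

(** * Eventually polynomial counts *)

Definition eventually_poly (f : nat -> nat) : Prop :=
  exists (p : {poly rat}) (N : nat),
    forall n, (N <= n)%N -> (f n)%:R = p.[n%:R].

Lemma eventually_poly_const (a N : nat) (f : nat -> nat) :
  (forall n, (N <= n)%N -> f n = a) -> eventually_poly f.
Proof.
by move=> h; exists (a%:R)%:P, N => n /h ->; rewrite hornerC.
Qed.

Lemma eventually_polyD (f g : nat -> nat) :
  eventually_poly f -> eventually_poly g ->
  eventually_poly (fun n => f n + g n)%N.
Proof.
move=> [p [N hp]] [q [M hq]]; exists (p + q), (maxn N M) => n.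
by rewrite geq_max => /andP[/hp e1 /hq e2]; rewrite natrD e1 e2 hornerD.
Qed.

Lemma eventually_poly_sum (K : nat) (f : nat -> nat -> nat) :
  (forall j, (j < K)%N -> eventually_poly (f j)) ->
  eventually_poly (fun n => \sum_(0 <= j < K) f j n)%N.
Proof.
elim: K => [|K IH] h.
  by apply: (@eventually_poly_const 0 0) => n _; rewrite big_nil.
have [p [N e]] : eventually_poly (fun n => \sum_(0 <= j < K) f j n + f K n)%N.
  by apply: eventually_polyD; [apply: IH => j jK; apply: h; lia | apply: h].
by exists p, N => n /e <-; rewrite big_nat_recr.
Qed.

Lemma eventually_poly_shift (j : nat) (f : nat -> nat) :
  eventually_poly f -> eventually_poly (fun n => f (n - j)%N).
Proof.
move=> [p [N h]]; exists (p \Po ('X - (j%:R)%:P)), (N + j)%N => n hn.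
rewrite h; last lia.
by rewrite horner_comp !hornerE natrB //; lia.
Qed.

(** Induction on the size: the difference of ['X ^+ n.+1] has degree [n] and leading coefficient
    [n.+1], which is invertible over the rationals, so a multiple of it removes the leading term of
    [p]. *)
Lemma antidifference (p : {poly rat}) :
  exists q : {poly rat}, q \Po ('X + 1) - q = p.
Proof.
have [n] := ubnP (size p); elim: n p => // n IH p.
rewrite ltnS leq_eqVlt => /predU1P[sp|]; last exact: IH.
case: n IH sp => [|n] IH sp.
  by move/eqP: sp; rewrite size_poly_eq0 => /eqP ->; exists 0; rewrite comp_poly0 subr0.
(* Here [p] has size [n.+1]; this factor makes the coefficient of degree [n] in [r] vanish. *)
pose a := p`_n / n.+1%:R.
pose r : {poly rat} := p - a *: (('X + 1) ^+ n.+1 - 'X ^+ n.+1).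
have [q eq] : exists q : {poly rat}, q \Po ('X + 1) - q = r.
  apply: IH; rewrite ltnS; apply/leq_sizeP => i hi.
  rewrite /r coefB coefZ coefB coefXn.
  have -> : (('X + 1 : {poly rat}) ^+ n.+1)`_i = 'C(n.+1, i)%:R.
    rewrite exprD1n coef_sum.
    have [iL|iG] := ltnP i n.+2; last first.
      rewrite bin_small // big1 // => j _.
      by rewrite coefMn coefXn; case: eqP (ltn_ord j) => [?|]; [lia|rewrite mul0rn].
    rewrite (bigD1 (Ordinal iL)) //= big1 ?addr0 => [|j /eqP jn].
      by rewrite coefMn coefXn eqxx.
    rewrite coefMn coefXn.
    by case: eqP => [e|]; rewrite ?mul0rn //; case: jn; apply: val_inj.
  have [->|ni] := eqVneq i n.
    rewrite binSn; have -> : (n == n.+1) = false by lia.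
    by rewrite subr0 /a divfK ?addNr ?pnatr_eq0 //; ring.
  have [->|ni'] := eqVneq i n.+1.
    by rewrite binn subrr mulr0 subr0 nth_default ?sp.
  have iG : (n.+1 < i)%N by lia.
  by rewrite bin_small // subrr mulr0 subr0 nth_default // sp; lia.
exists (q + a *: 'X ^+ n.+1).
rewrite comp_polyD comp_polyZ rmorphXn /= comp_polyX.
have -> : p = r + a *: (('X + 1) ^+ n.+1 - 'X ^+ n.+1) by rewrite /r subrK.
by rewrite -eq scalerBr; ring.
Qed.

Lemma eventually_poly_partial_sum (f : nat -> nat) :
  eventually_poly f ->
  eventually_poly (fun n => \sum_(0 <= i < n.+1) f i)%N.
Proof.
move=> [p [N h]]; have [q qE] := antidifference p.
have qS m : q.[m.+1%:R] = q.[m%:R] + p.[m%:R].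
  by have := congr1 (horner^~ m%:R) qE; rewrite !hornerE horner_comp !hornerE natr1 => <-; ring.
(* The sum of [f] below [m] telescopes to [q.[m%:R] + a] once [m] is at least [N]; the constant
   absorbs the values of [f] below [N], where [p] need not describe it. *)
pose a := (\sum_(0 <= i < N) f i)%N%:R - q.[N%:R].
exists (q \Po ('X + 1) + a%:P), N => n hn.
have -> : (q \Po ('X + 1) + a%:P).[n%:R] = q.[n.+1%:R] + a.
  by rewrite !hornerE horner_comp !hornerE natr1.
have : (N <= n.+1)%N by lia.
elim: n.+1 => [|m IH] hm.
  have N0 : N = 0%N by lia.
  by rewrite /a N0; ring.
have [Nm|Nm] := eqVneq N m.+1.
  by rewrite /a Nm; ring.
have {}hm : (N <= m)%N by lia.
by rewrite big_nat_recr //= natrD IH // h // qS; ring.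
Qed.

(** * Weak compositions and sets determined by truncated coordinates *)

Fixpoint weak_compositions (d n : nat) : seq (seq nat) :=
  if d is d'.+1 then
    flatten [seq [seq j :: m | m <- weak_compositions d' (n - j)] | j <- iota 0 n.+1]
  else if n is 0 then [:: [::]] else [::].

Lemma weak_compositionsS (d n : nat) :
  weak_compositions d.+1 n =
  flatten [seq [seq j :: m | m <- weak_compositions d (n - j)] | j <- iota 0 n.+1].
Proof. by []. Qed.

Lemma mem_weak_compositions (d n : nat) (m : seq nat) :
  (m \in weak_compositions d n) = (size m == d) && (sumn m == n).
Proof.
elim: d n m => [|d IH] n m.
  by case: n => [|n]; case: m => [|a m].
rewrite weak_compositionsS; apply/allpairsPdep/idP => [[j [m' []]]|].
  by rewrite mem_iota IH => jn /andP[/eqP sm /eqP nm] -> /=; lia.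
case: m => [//|a m] h; rewrite /= in h; exists a, m; split=> //.
  by rewrite mem_iota; lia.
by rewrite IH; lia.
Qed.

Lemma weak_compositions_uniq (d n : nat) : uniq (weak_compositions d n).
Proof.
elim: d n => [|d IH] n; first by case: n.
apply: (@allpairs_uniq_dep _ _ _ (fun j m => j :: m)) => //.
- exact: iota_uniq.
- by move=> [j m] [j' m'] /= h h' [ej em]; subst.
Qed.

(** For vectors of fixed length, the classes of this relation are products of single points below
    [K] and rays starting at [K]. *)
Definition eq_trunc (K : nat) (m m' : seq nat) : Prop :=
  forall i, minn K (nth 0%N m i) = minn K (nth 0%N m' i).

Lemma eq_trunc_le (K L : nat) (m m' : seq nat) :
  (K <= L)%N -> eq_trunc L m m' -> eq_trunc K m m'.
Proof. by move=> KL h i; have := h i; lia. Qed.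

Lemma eq_trunc_cons (K a b : nat) (m m' : seq nat) :
  minn K a = minn K b -> eq_trunc K m m' -> eq_trunc K (a :: m) (b :: m').
Proof. by move=> ab h [|i]; [exact: ab | exact: h]. Qed.

(** Induction on [d], slicing by the first entry [j]. Each slice with [j < K] contributes a shifted
    count in dimension [d]; all slices with [j >= K] impose the same condition as [j = K], so
    together they contribute a partial sum of one such count. *)
Lemma count_eventually_poly (d K : nat) (P : seq nat -> bool) :
  (forall m m', size m = d -> size m' = d -> eq_trunc K m m' -> P m = P m') ->
  eventually_poly (fun n => count P (weak_compositions d n)).
Proof.
elim: d P => [|d IH] P hP.
  (* The empty vector has sum 0, so the count vanishes from [n = 1] on. *)
  by apply: (@eventually_poly_const 0 1) => -[].
have IHc j : eventually_poly (fun n => count (fun m => P (j :: m)) (weak_compositions d n)).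
  apply: IH => m m' sm sm' h; apply: hP; rewrite /= ?sm ?sm' //.
  exact: eq_trunc_cons.
have [p [N e]] : eventually_poly (fun n =>
    \sum_(0 <= j < K) count (fun m => P (j :: m)) (weak_compositions d (n - j))
    + (fun n' => \sum_(0 <= i < n'.+1)
        count (fun m => P (K :: m)) (weak_compositions d i)) (n - K))%N.
  apply: eventually_polyD.
    apply: (@eventually_poly_sum K (fun j n => count _ (weak_compositions d (n - j)))) => j _.
    exact: (eventually_poly_shift j _ (IHc j)).
  apply: (eventually_poly_shift K (fun n' => \sum_(0 <= i < n'.+1) count _ (weak_compositions d i))%N).
  exact/eventually_poly_partial_sum/IHc.
exists p, (maxn N K) => n; rewrite geq_max => /andP[Nn Kn]; rewrite -e //; congr (_%:R).
rewrite weak_compositionsS count_flatten -map_comp sumnE big_map.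
rewrite -[iota 0 n.+1]/(index_iota 0 n.+1) (big_cat_nat (n := K)) //=; last lia.
congr (_ + _)%N.
  by apply: eq_big_nat => j _; rewrite /= count_map.
(* Reindex by the sum [i = n - j] left for the other entries. *)
rewrite big_nat_rev /= -{1}[K]add0n big_addn.
have -> : (n.+1 - K = (n - K).+1)%N by lia.
apply: eq_big_nat => i hi /=; rewrite count_map.
have -> : (n - (K + n.+1 - (i + K).+1) = i)%N by lia.
apply: eq_in_count => m; rewrite mem_weak_compositions => /andP[/eqP sm _] /=.
by apply: hP; rewrite /= ?sm //; apply: eq_trunc_cons => //; lia.
Qed.

(* Dickson's lemma, with truncation in place of a finite set of generators. *)
Lemma upset_eq_trunc (d : nat) (U : seq nat -> Prop) :
  (forall m m', size m = d -> size m' = d ->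
     (forall i, (nth 0 m i <= nth 0 m' i)%N) -> U m -> U m') ->
  exists K, forall m m', size m = d -> size m' = d -> eq_trunc K m m' ->
    U m -> U m'.
Proof.
elim: d U => [|d IH] U up.
  by exists 0%N => m m' /size0nil -> /size0nil ->.
have upc (a b : nat) (m m' : seq nat) : (a <= b)%N -> size m = d -> size m' = d ->
    (forall i, (nth 0 m i <= nth 0 m' i)%N) -> U (a :: m) -> U (b :: m').
  by move=> ab sm sm' h; apply: up => /=; rewrite ?sm ?sm' // => -[|i] /=.
(* The union of all slices of [U] along the first coordinate is an up-set in dimension [d]. *)
have [L hL] : exists L, forall m m', size m = d -> size m' = d -> eq_trunc L m m' ->
    (exists k, U (k :: m)) -> exists k, U (k :: m').
  by apply: IH => m m' sm sm' h [k Uk]; exists k; apply: upc Uk.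
(* There are finitely many vectors truncated at [L]; for each that lies in some slice, [kof] picks
   such a slice. From their maximum [k0] on, every slice is the whole union. *)
have /choice[kof kofP] (t : d.-tuple 'I_L.+1) : exists k : nat,
    (exists k, U (k :: map val t)) -> U (k :: map val t).
  by have [[k hk]|no] := EM (exists k, U (k :: map val t)); [exists k | exists 0%N].
pose k0 := \max_t kof t.
(* The finitely many slices below [k0] get their own bounds by induction. *)
have /choice[Kof KofP] j : exists K, forall m m', size m = d -> size m' = d ->
    eq_trunc K m m' -> U (j :: m) -> U (j :: m').
  by apply: (IH (fun m => U (j :: m))) => m m' sm sm' h; apply: upc.
pose K1 := \max_(j < k0) Kof j.
exists (maxn k0 (maxn L K1)) => -[//|a m] [//|b m'] [sm] [sm'] h Ua.
have hab := h 0%N; rewrite /= in hab.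
have hm : eq_trunc (maxn k0 (maxn L K1)) m m' by move=> i; exact: (h i.+1).
have [ak|ka] := ltnP a k0.
  have <- : a = b by lia.
  apply: KofP Ua => //; apply: eq_trunc_le hm.
  have : (Kof a <= K1)%N by exact: (@leq_bigmax _ (fun j : 'I_k0 => Kof j) (Ordinal ak)).
  by lia.
have kb : (k0 <= b)%N by lia.
(* The truncation of [m'] lies in the union of slices because [m] does; it then lies in slice
   [kof t], and [kof t <= k0 <= b] lets [U] be climbed to [b :: m']. *)
pose t : d.-tuple 'I_L.+1 := [tuple inord (minn L (nth 0%N m' i)) | i < d].
have tE : map val t = [seq minn L x | x <- m'].
  apply: (@eq_from_nth _ 0%N); rewrite size_map size_tuple; first by rewrite size_map.
  move=> i id; rewrite (nth_map ord0) ?size_tuple // (nth_map 0%N) ?sm' //.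
  by rewrite -[i]/(val (Ordinal id)) -tnth_nth tnth_mktuple /= inordK // ltnS geq_minl.
have sz : size (map val t) = d by rewrite tE size_map.
have ntrunc i : nth 0%N (map val t) i = minn L (nth 0%N m' i).
  rewrite tE; have [id|id] := ltnP i (size m'); first by rewrite (nth_map 0%N).
  by rewrite !nth_default ?size_map // minn0.
have : exists k, U (k :: map val t).
  apply: (hL m) => //; last by exists a.
  by move=> i; rewrite ntrunc; have := hm i; lia.
move/kofP; apply: upc => // [|i]; last by rewrite ntrunc geq_minr.
by apply: leq_trans kb; exact: (@leq_bigmax _ kof t).
Qed.

(** * Primary components of squarefree monomial ideals *)

Definition set_monomial {k : fieldType} {N : nat} (A : {set 'I_N}) : {mpoly k[N]} :=
  \prod_(v in A) 'X_v.

Definition mnm_support {N : nat} (a : 'X_{1..N}) : {set 'I_N} :=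
  [set v | (a v != 0)%N].

(** Setting the variables outside [F] to zero is a ring morphism into a domain, so its kernel is
    prime without any argument on generators. *)
Definition restrict_vars {k : fieldType} {N : nat} (F : {set 'I_N})
    (f : {mpoly k[N]}) : {mpoly k[N]} :=
  comp_mpoly [tuple (if v \in F then 'X_v else 0) | v < N] f.

(* The prime generated by the variables outside F. *)
Definition face_prime {k : fieldType} {N : nat} (F : {set 'I_N}) : set {mpoly k[N]} :=
  [set f | restrict_vars F f = 0].

Section FacePrimes.
Context {k : fieldType} {N : nat}.
Implicit Types (F G A : {set 'I_N}) (f g : {mpoly k[N]}) (I : set {mpoly k[N]}).

Lemma restrict_varsM F f g : restrict_vars F (f * g) = restrict_vars F f * restrict_vars F g.
Proof. exact: rmorphM. Qed.

Lemma restrict_varsX F v : restrict_vars F ('X_v : {mpoly k[N]}) = if v \in F then 'X_v else 0.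
Proof. by rewrite /restrict_vars comp_mpolyXU -tnth_nth tnth_mktuple. Qed.

Lemma restrict_vars_mnm F (a : 'X_{1..N}) :
  restrict_vars F ('X_[a] : {mpoly k[N]}) = if mnm_support a \subset F then 'X_[a] else 0.
Proof.
rewrite /restrict_vars comp_mpolyX; case: ifPn => [/fintype.subsetP sub|/fintype.subsetPn[v]].
  rewrite mpolyXE_id; apply: eq_bigr => v _; rewrite tnth_mktuple.
  have [->|av] := eqVneq (a v) 0%N; first by rewrite !expr0.
  by rewrite sub // inE.
rewrite inE => av vF; rewrite (bigD1 v) //= tnth_mktuple (negPf vF) expr0n.
by rewrite (negPf av) mul0r.
Qed.

Lemma restrict_vars_set F A :
  restrict_vars F (set_monomial A : {mpoly k[N]}) = if A \subset F then set_monomial A else 0.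
Proof.
rewrite /restrict_vars rmorph_prod /=; case: ifPn => [/fintype.subsetP sub|/fintype.subsetPn[v vA vF]].
  by apply: eq_bigr => v vA; rewrite -/(restrict_vars F _) restrict_varsX sub.
by rewrite (bigD1 v) //= -/(restrict_vars F _) restrict_varsX (negPf vF) mul0r.
Qed.

Lemma coeff_restrict_vars F f (a : 'X_{1..N}) :
  (restrict_vars F f)@_a = if mnm_support a \subset F then f@_a else 0.
Proof.
rewrite /restrict_vars comp_mpolyEX raddf_sum /=.
under eq_bigr => b _ do rewrite mcoeffZ -/(restrict_vars F _) restrict_vars_mnm.
rewrite [in RHS](mpolyE f) raddf_sum /=; case: ifPn => sub.
  apply: eq_bigr => b _; rewrite mcoeffZ; case: ifPn => // /negPf nb.
  rewrite mcoeff0 mcoeffX; case: eqP => [e|]; last by rewrite mulr0.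
  by rewrite e sub in nb.
rewrite big1 // => b _; case: ifPn => nb; last by rewrite mcoeff0 mulr0.
by rewrite mcoeffX; case: eqP => [e|]; rewrite ?mulr0 // -e nb in sub *.
Qed.

Lemma set_monomial_neq0 A : (set_monomial A : {mpoly k[N]}) != 0.
Proof.
apply/prodf_neq0 => v _; apply/eqP => /(congr1 (mcoeff U_(v))) /eqP.
by rewrite mcoeffX eqxx mcoeff0 oner_eq0.
Qed.

Lemma set_monomialE A :
  (set_monomial A : {mpoly k[N]}) = 'X_[[multinom nat_of_bool (v \in A) | v < N]].
Proof.
rewrite mpolyXE_id /set_monomial big_mkcond; apply: eq_bigr => v _.
by rewrite mnmE; case: ifP.
Qed.

Lemma face_primeM F f g : face_prime F (f * g) <-> face_prime F f \/ face_prime F g.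
Proof.
rewrite /face_prime /= restrict_varsM; split=> [/eqP|].
  by rewrite mulf_eq0 => /orP[]/eqP; [left|right].
by case=> ->; rewrite ?mul0r ?mulr0.
Qed.

Lemma face_prime_ideal F : is_ideal (face_prime F : set {mpoly k[N]}).
Proof.
split=> [|f g Ff Fg|f g Fg]; rewrite /face_prime /=; first exact: rmorph0.
  by rewrite /restrict_vars comp_mpolyD -!/(restrict_vars F _) Ff Fg addr0.
by rewrite restrict_varsM Fg mulr0.
Qed.

Lemma face_prime1 F : ~ face_prime F (1 : {mpoly k[N]}).
Proof. by rewrite /face_prime /restrict_vars /= rmorph1; apply/eqP/oner_neq0. Qed.

Lemma face_primeX F f (e : nat) : face_prime F (f ^+ e) -> face_prime F f.
Proof.
elim: e => [|e IH]; first by rewrite expr0 => /face_prime1.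
by rewrite exprS => /face_primeM[].
Qed.

Lemma face_prime_radical F : radical (face_prime F : set {mpoly k[N]}) = face_prime F.
Proof.
apply/seteqP; split=> f; first by move=> [e]; exact: face_primeX.
by exists 1%N; rewrite expr1.
Qed.

Lemma face_prime_primary F : primary_ideal (face_prime F : set {mpoly k[N]}).
Proof.
split; [exact: face_prime_ideal | exact: face_prime1 | ].
by move=> f g /face_primeM; rewrite face_prime_radical.
Qed.

Lemma face_prime_monomial F A :
  face_prime F (set_monomial A : {mpoly k[N]}) <-> ~~ (A \subset F).
Proof.
rewrite /face_prime /= restrict_vars_set; case: ifP => _ //; split=> // /eqP e.
by rewrite (negPf (set_monomial_neq0 A)) in e.
Qed.

Lemma face_prime_inj : injective (face_prime : {set 'I_N} -> set {mpoly k[N]}).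
Proof.
have sub F G : face_prime F = face_prime G :> set {mpoly k[N]} -> F \subset G.
  move=> e; apply: contraT => /face_prime_monomial.
  by rewrite -e => /face_prime_monomial; rewrite subxx.
by move=> F G e; apply/eqP; rewrite finset.eqEsubset !sub.
Qed.

Lemma ideal_monomial_sub I A A' : is_ideal I -> A \subset A' ->
  I (set_monomial A) -> I (set_monomial A').
Proof.
move=> [_ _ IM] sub IA; have := IM (set_monomial (A' :\: A)) _ IA; congr I.
by rewrite mulrC /set_monomial [RHS](finset.big_setID A) /= (finset.setIidPr sub).
Qed.

(** Facets of the Stanley-Reisner complex. Maximality is tested on single added variables, the form
    that translates to type vectors; [facet_max] recovers the full maximality. *)
Definition facet I F : Prop :=
  ~ I (set_monomial F) /\ forall v, v \notin F -> I (set_monomial (v |: F)).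

Lemma facet_max I F A : is_ideal I -> facet I F -> F \subset A -> ~ I (set_monomial A) -> A = F.
Proof.
move=> idI [_ Fmax] sub nA; apply/eqP; rewrite finset.eqEsubset sub andbT.
apply/fintype.subsetP => v vA; apply: contra_notT nA => /Fmax; apply: ideal_monomial_sub => //.
by rewrite finset.subUset finset.sub1set vA.
Qed.

Lemma face_facet I A : is_ideal I -> ~ I (set_monomial A) ->
  exists2 F, facet I F & A \subset F.
Proof.
move=> idI nA.
pose face (B : {set 'I_N}) := `[< ~ I (set_monomial B) >].
have [F /maxsetP[/asboolP nF Fmax] AF] := @maxset_exists _ face A (asboolT nA).
exists F => //; split=> // v vF.
apply: contrapT => nv; move/asboolP: nv => /Fmax -/(_ (finset.subsetUr _ _)) e.
by move: vF; rewrite -e !inE eqxx.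
Qed.

End FacePrimes.

(** * Facet primes as primary components *)

Section Components.
Context {k : fieldType} {N : nat}.
Variables (S : set 'X_{1..N}) (I : set {mpoly k[N]}).
Hypothesis sqfS : forall a, S a -> forall v, (a v <= 1)%N.
Hypothesis IE : I = ideal_span [set ('X_[a] : {mpoly k[N]}) | a in S].
Hypothesis idI : is_ideal I.

(** A generator outside P_F has its support inside [F]; being squarefree, it then divides x^F, which
    is not in [I]. *)
Lemma sub_facet_prime F : facet I F -> I `<=` face_prime F.
Proof.
move=> [nF _]; rewrite IE; apply: smallest_sub; first exact: face_prime_ideal.
move=> _ [a Sa <-]; rewrite /face_prime /= restrict_vars_mnm; case: ifPn => // sub.
case: nF; apply: (ideal_monomial_sub _ (mnm_support a)) => //.
have -> : set_monomial (mnm_support a) = 'X_[a] :> {mpoly k[N]}.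
  rewrite set_monomialE; congr 'X_[_]; apply/mnmP => v; rewrite mnmE inE.
  by have := sqfS a Sa v; case: (a v) => [|[]].
by rewrite IE; apply: sub_gen_smallest; exists a.
Qed.

(** For the reverse inclusion, take each monomial x^a of [f]. Either the product over its support is
    in [I], and so is its multiple x^a, or the support lies in a facet [F] and membership of [f] in
    P_F makes the coefficient zero. *)
Lemma bigcap_facet_primes : I = \bigcap_(F in facet I) face_prime F.
Proof.
apply/seteqP; split=> [f If F Ff|f Pf]; first exact: (sub_facet_prime F Ff).
have [I0 ID IM] := idI.
rewrite (mpolyE f); apply: (big_ind I) => // a _; case: (EM (I (set_monomial (mnm_support a)))).
  move=> Ia; rewrite -mul_mpolyC; apply: (IM).
  have := IM 'X_[[multinom (a v - (v \in mnm_support a))%N | v < N]] _ Ia; congr I.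
  rewrite set_monomialE -mpolyXD; congr 'X_[_]; apply/mnmP => v.
  by rewrite mnmDE !mnmE inE; case: (a v) => //= b; rewrite subn1 addn1.
move=> /(face_facet _ _ idI)[F Ff sub]; have := Pf F Ff; rewrite /face_prime /=.
move/(congr1 (fun g => g@_a)); rewrite coeff_restrict_vars sub mcoeff0 => ->.
by rewrite scale0r.
Qed.

Lemma facet_primes_decomposition :
  minimal_primary_decomposition I [set face_prime F | F in facet I].
Proof.
split.
- exact/finite_image/finite_finset.
- by move=> _ [F _ <-]; exact: face_prime_primary.
- by rewrite bigcap_image; exact: bigcap_facet_primes.
- move=> P Q; rewrite !inE => -[F _ <-] [G _ <-].
  by rewrite !face_prime_radical.
(* Irredundancy: x^F lies in all the other facet primes, yet not in [I]. *)
- move=> _ [F Ff <-] e; case: (Ff) => nF _; apply: nF; rewrite -e => _ [[G Fg <-] nG].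
  apply/face_prime_monomial; apply/negP => sub; apply: nG => /=; congr face_prime.
  by apply: (facet_max I) => //; case: Fg.
Qed.

(* For a facet F the squarefree monomial x^F lies in every facet prime but P_F,
   so x^F P_F is contained in I; this pins down the P_F-primary component. *)
Lemma primary_componentsE : primary_components I = [set face_prime F | F in facet I].
Proof.
apply/seteqP; split=> [Q [Qs [_ prim IQ _ min] QsQ]|Q QF]; last first.
  by exists [set face_prime F | F in facet I] => //; exact: facet_primes_decomposition.
have IsubQ : I `<=` Q by rewrite IQ => f; apply.
(* Irredundancy of [Qs] gives [f] in all the other components but not in [I]; some facet prime P_F
   then omits [f]. *)
have [f fQ nIf] : exists2 f, (\bigcap_(Q' in Qs `\ Q) Q') f & ~ I f.
  apply: contrapT => no; apply: (min Q QsQ); apply/seteqP; split=> g; last first.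
    by rewrite IQ => h Q' [/h].
  by move=> gQ; apply: contrapT => ng; apply: no; exists g.
have [F Ff nFf] : exists2 F, facet I F & ~ face_prime F f.
  apply: contrapT => no; apply: nIf; rewrite bigcap_facet_primes => F Ff.
  by apply: contrapT => nf; apply: no; exists F.
exists F => //; have radQF : radical Q `<=` face_prime F.
  (* The product [g ^+ e * f] is in every component, hence in [I] and in P_F, which omits [f]. *)
  move=> g [e Qg]; have /(sub_facet_prime F Ff)/face_primeM[/face_primeX|] // : I (g ^+ e * f).
  rewrite IQ => Q' QsQ'; have [[_ _ QM] _ _] := prim Q' QsQ'.
  have [->|/eqP nQ] := EM (Q' = Q); last first.
    by apply: QM; apply: fQ; split=> // /= e'; move/eqP: nQ.
  by have [[_ _ QM'] _ _] := prim Q QsQ; rewrite mulrC; apply: QM'.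
have [_ _ primQ] := prim Q QsQ.
apply/seteqP; split=> g; last by move=> Qg; apply: radQF; exists 1%N; rewrite expr1.
(* Conversely [g] times x^F is in [Q], and x^F is not in the radical of [Q], which lies in P_F. *)
move=> Fg; case: (primQ g (set_monomial F)) => //.
  apply: IsubQ; rewrite bigcap_facet_primes => G Gf; apply/face_primeM.
  have [FG|/eqP nFG] := EM (G = F); first by left; rewrite FG.
  right; apply/face_prime_monomial; apply: contra nFG => sub.
  by apply/eqP; apply: (facet_max I) => //; case: Gf.
by move/radQF/face_prime_monomial; rewrite subxx.
Qed.

End Components.

(** * Column types and the symmetric group action *)

(** Reduces identities between composed renamings and restrictions to a check on variables. *)
Lemma comp_mpoly_comp (R : comNzRingType) (l m n : nat)
    (p : l.-tuple {mpoly R[m]}) (q : m.-tuple {mpoly R[n]}) (f : {mpoly R[l]}) :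
  comp_mpoly q (comp_mpoly p f) = comp_mpoly [tuple of map (comp_mpoly q) p] f.
Proof.
rewrite (comp_mpolyEX f p) [RHS]comp_mpolyEX raddf_sum /=; apply: eq_bigr => a _.
rewrite comp_mpolyZ !comp_mpolyX rmorph_prod /=; congr (_ *: _).
by apply: eq_bigr => i _; rewrite rmorphXn /= tnth_map.
Qed.

Definition push {c m n : nat} (phi : 'I_m -> 'I_n) (v : 'I_(c * m)) : 'I_(c * n) :=
  mxvec_index (var_index v).1 (phi (var_index v).2).

Definition column {c n : nat} (F : {set 'I_(c * n)}) (j : 'I_n) : {set 'I_c} :=
  [set i | mxvec_index i j \in F].

Definition columns {c n : nat} (F : {set 'I_(c * n)}) : n.-tuple {set 'I_c} :=
  [tuple column F j | j < n].

(* The complete invariant of the Sym(n)-orbit of a set of variables. *)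
Definition type_vector {c : nat} (ts : seq {set 'I_c}) : seq nat :=
  [seq count_mem T ts | T <- enum {set 'I_c}].

Section Columns.
Context {c : nat}.
Implicit Types (ts : seq {set 'I_c}) (T : {set 'I_c}).

Lemma mxvec_indexK (n : nat) (i : 'I_c) (j : 'I_n) : var_index (mxvec_index i j) = (i, j).
Proof. by rewrite /var_index /mxvec_index cast_ordK enum_rankK. Qed.

Lemma var_indexK (n : nat) (v : 'I_(c * n)) :
  mxvec_index (var_index v).1 (var_index v).2 = v.
Proof.
by rewrite /var_index /mxvec_index -surjective_pairing enum_valK cast_ordKV.
Qed.

Lemma push_id (n : nat) (v : 'I_(c * n)) : push id v = v.
Proof. exact: var_indexK. Qed.

Lemma push_comp (l m n : nat) (phi : 'I_l -> 'I_m) (psi : 'I_m -> 'I_n) (v : 'I_(c * l)) :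
  push psi (push phi v) = push (psi \o phi) v.
Proof. by rewrite /push mxvec_indexK. Qed.

Lemma push_permK (n : nat) (s : 'S_n) : cancel (@push c _ _ (s^-1)%g) (push s).
Proof.
by move=> v; rewrite push_comp -[RHS]push_id /push /= permKV.
Qed.

Lemma push_inj (m n : nat) (phi : 'I_m -> 'I_n) : injective phi -> injective (@push c _ _ phi).
Proof.
move=> inj u v /(congr1 (@var_index c n)); rewrite !mxvec_indexK => -[e1 /inj e2].
by rewrite -[u]var_indexK -[v]var_indexK e1 e2.
Qed.

Lemma in_column (n : nat) (F : {set 'I_(c * n)}) v :
  ((var_index v).1 \in column F (var_index v).2) = (v \in F).
Proof. by rewrite inE var_indexK. Qed.

Lemma columns_surj (n : nat) (t : n.-tuple {set 'I_c}) :
  exists F : {set 'I_(c * n)}, columns F = t.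
Proof.
exists [set v | (var_index v).1 \in tnth t (var_index v).2]%SET.
apply: eq_from_tnth => j; rewrite tnth_mktuple; apply/setP => i.
by rewrite !inE mxvec_indexK.
Qed.

Lemma size_type_vector ts : size (type_vector ts) = #|{set 'I_c}|.
Proof. by rewrite size_map -cardT. Qed.

Lemma nth_type_vector ts T :
  nth 0%N (type_vector ts) (index T (enum {set 'I_c})) = count_mem T ts.
Proof. by rewrite (nth_map T) ?nth_index ?index_mem ?mem_enum. Qed.

Lemma eq_type_vector ts ts' : type_vector ts = type_vector ts' <-> perm_eq ts ts'.
Proof.
split=> [e|/seq.permP e]; last by apply: eq_map => T; exact: e.
by apply/allP => T _ /=; rewrite -!nth_type_vector e.
Qed.

Lemma sumn_type_vector ts : sumn (type_vector ts) = size ts.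
Proof.
rewrite sumnE big_map big_enum /=; elim: ts => [|T ts IH] /=.
  by rewrite big1.
rewrite big_split /= IH (bigD1 T) //= eqxx big1 ?add1n // => T'.
by rewrite eq_sym => /negPf ->.
Qed.

Lemma nth_type_vector_cat ts ts' i :
  nth 0%N (type_vector (ts ++ ts')) i =
  (nth 0 (type_vector ts) i + nth 0 (type_vector ts') i)%N.
Proof.
rewrite /type_vector; elim: (enum _) i => [|T e IH] [|i] //=.
exact: count_cat.
Qed.

Lemma type_vector_surj (m : seq nat) :
  size m = #|{set 'I_c}| -> exists ts, type_vector ts = m.
Proof.
rewrite cardT /type_vector; have := enum_uniq {set 'I_c}.
elim: (enum _) m => [|T e IH] [|a m] //=; first by exists [::].
move=> /andP[Te ue] [sm]; have [ts tsm] := IH m ue sm.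
(* The list [ts] from the induction may contain [T] any number of times; those copies are
   dropped. *)
exists (nseq a T ++ [seq T' <- ts | T' != T]); congr (_ :: _).
  rewrite count_cat count_nseq /= eqxx mul1n count_filter.
  by rewrite (@eq_count _ _ pred0) ?count_pred0 ?addn0 // => x /=; case: eqP.
rewrite -tsm; apply/eq_in_map => T' T'e; rewrite count_cat count_nseq /=.
have nT : T' != T by apply: contraNneq Te => <-.
rewrite eq_sym (negPf nT) add0n count_filter; apply: eq_count => x /=.
by case: eqP => // ->.
Qed.

Lemma perm_eq_columns (n : nat) (F G : {set 'I_(c * n)}) :
  perm_eq (columns F) (columns G) <->
  exists s : 'S_n, forall j, column G (s j) = column F j.
Proof.
split=> [/tuple_permP[s e]|[s e]].
  exists s => j; have := congr1 (fun t => tnth t j) (val_inj e : columns F = _).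
  by rewrite !tnth_mktuple => ->.
apply/tuple_permP; exists s; congr val; apply: eq_from_tnth => j.
by rewrite !tnth_mktuple e.
Qed.

Lemma count_columns (n : nat) (F : {set 'I_(c * n)}) T :
  count_mem T (columns F) = (\sum_j (column F j == T))%N.
Proof.
rewrite count_map -sum1_count big_enum_cond big_mkcond; apply: eq_bigr => j _ /=.
by case: (_ == _).
Qed.

End Columns.

(** Effect on a type vector of turning one column of type number [p] into one of type number [q]. It
    is meaningful when entry [p] is positive. *)
Definition move_unit (m : seq nat) (p q : nat) : seq nat :=
  incr_nth (set_nth 0%N m p (nth 0%N m p).-1) q.

Lemma nth_move_unit (m : seq nat) (p q i : nat) :
  nth 0%N (move_unit m p q) i = ((q == i) + (nth 0 m i - (p == i)))%N.
Proof.
rewrite nth_incr_nth nth_set_nth /=; congr (_ + _)%N; rewrite eq_sym.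
by case: eqP => [->|_]; rewrite ?subn1 ?subn0.
Qed.

Lemma size_move_unit (m : seq nat) (p q : nat) :
  (p < size m)%N -> (q < size m)%N -> size (move_unit m p q) = size m.
Proof.
move=> pm qm; rewrite size_incr_nth size_set_nth.
by rewrite (maxn_idPr pm) qm.
Qed.

Lemma type_vector_add (c n : nat) (F : {set 'I_(c * n)}) (v : 'I_(c * n)) :
  v \notin F ->
  let T := column F (var_index v).2 in
  type_vector (columns (v |: F)) =
  move_unit (type_vector (columns F)) (index T (enum {set 'I_c}))
    (index ((var_index v).1 |: T) (enum {set 'I_c})).
Proof.
move=> vF T; set i := (var_index v).1; set j := (var_index v).2.
have ltE (T' : {set 'I_c}) (ts : seq {set 'I_c}) :
    (index T' (enum {set 'I_c}) < size (type_vector ts))%N.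
  by rewrite size_map index_mem mem_enum.
apply: (@eq_from_nth _ 0%N) => [|p].
  by rewrite size_move_unit ?ltE // !size_type_vector.
rewrite size_map => pd; rewrite nth_move_unit.
have [T' ->] : exists T', p = index T' (enum {set 'I_c}).
  by exists (nth finset.set0 (enum {set 'I_c}) p); rewrite index_uniq ?enum_uniq.
rewrite !nth_type_vector !count_columns (bigD1 j) //= [in RHS](bigD1 j) //=.
have inj_idx (A B : {set 'I_c}) :
    (index A (enum {set 'I_c}) == index B (enum {set 'I_c})) = (A == B).
  apply/eqP/eqP => [|-> //] /(congr1 (nth finset.set0 (enum {set 'I_c}))).
  by rewrite !nth_index ?mem_enum.
rewrite !inj_idx -/T addKn; congr (_ + _)%N.
  congr (nat_of_bool (_ == _)); apply/setP => i'; rewrite !inE -{1}[v]var_indexK -/i -/j.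
  congr (_ || _); apply/eqP/eqP => [/(congr1 (@var_index c n))|-> //].
  by rewrite !mxvec_indexK => -[].
apply: eq_bigr => j' /eqP jj'; congr (nat_of_bool (_ == _)); apply/setP => i'.
rewrite !inE; case: eqP => // /(congr1 (@var_index c n)).
by rewrite mxvec_indexK => e; case: jj'; rewrite /j -e.
Qed.

(** * Renaming of variables and orbits of face primes *)

Section Rename.
Context {c : nat} {k : fieldType}.

Lemma renameX (m n : nat) (phi : 'I_m -> 'I_n) (v : 'I_(c * m)) :
  rename phi ('X_v : Rn c k m) = 'X_(push phi v).
Proof. by rewrite /rename comp_mpolyXU -tnth_nth tnth_mktuple. Qed.

Lemma rename_set_monomial (m n : nat) (phi : 'I_m -> 'I_n) (A : {set 'I_(c * m)}) :
  injective phi ->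
  rename phi (set_monomial A : Rn c k m) = set_monomial [set push phi v | v in A]%SET.
Proof.
move=> inj; rewrite /rename /set_monomial rmorph_prod big_imset /=.
  by apply: eq_bigr => v _; exact: renameX.
by move=> u v _ _; exact: push_inj.
Qed.

Lemma rename_permK (n : nat) (s : 'S_n) (f : Rn c k n) : rename s (rename (s^-1)%g f) = f.
Proof.
rewrite /rename comp_mpoly_comp -[RHS]comp_mpoly_id; congr comp_mpoly.
apply: eq_from_tnth => v; rewrite tnth_map !tnth_mktuple.
by rewrite -/(rename s _) renameX -[in RHS](push_permK n s v).
Qed.

Lemma restrict_vars_rename (n : nat) (s : 'S_n) (F G : {set 'I_(c * n)}) (f : Rn c k n) :
  (forall v, (push s v \in G) = (v \in F)) ->
  restrict_vars G (rename s f) = rename s (restrict_vars F f).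
Proof.
move=> FG; rewrite /rename /restrict_vars !comp_mpoly_comp; congr comp_mpoly.
apply: eq_from_tnth => v; rewrite !tnth_map !tnth_ord_tuple.
rewrite -/(restrict_vars _ _) restrict_varsX FG; case: ifP => _.
  by rewrite -/(rename _ _) renameX.
by rewrite comp_mpoly0.
Qed.

Lemma sym_act_face_prime (n : nat) (s : 'S_n) (F G : {set 'I_(c * n)}) :
  (forall v, (push s v \in G) = (v \in F)) ->
  sym_act s @` (face_prime F : set (Rn c k n)) = face_prime G.
Proof.
move=> FG; apply/seteqP; split=> [_ [f Ff <-]|g Gg].
  by rewrite /face_prime /= (restrict_vars_rename n s F) // Ff /rename comp_mpoly0.
exists (rename (s^-1)%g g); last exact: rename_permK.
rewrite /face_prime /= (restrict_vars_rename n (s^-1)%g G) => [|v].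
  by rewrite Gg /rename comp_mpoly0.
by rewrite -FG push_permK.
Qed.

(** Permuting columns carries P_F to the prime of the permuted set, and two column tuples differ by
    a permutation exactly when their type vectors agree. *)
Lemma sym_orbit_face_prime (n : nat) (F : {set 'I_(c * n)}) :
  sym_orbit (face_prime F : set (Rn c k n)) =
  [set face_prime G | G in [set G | type_vector (columns G) = type_vector (columns F)]].
Proof.
apply/seteqP; split=> [_ [s _ <-]|_ [G GF <-]].
  exists [set v | push (s^-1)%g v \in F]%SET.
    apply/esym/eq_type_vector/perm_eq_columns; exists s => j; apply/setP => i.
    by rewrite !inE /push mxvec_indexK /= permK.
  apply/esym/sym_act_face_prime => v; rewrite inE; congr (_ \in F).
  by have := push_permK n (s^-1)%g v; rewrite invgK.
have /eq_type_vector/perm_eq_columns[s e] := esym GF; exists s => //.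
apply: sym_act_face_prime => v; rewrite -!in_column /push mxvec_indexK /= e.
by [].
Qed.

End Rename.

(** * Nonfaces and facets along the chain *)

Section Chain.
Context {c : nat} {k : fieldType}.
Variable I : forall n : nat, set (Rn c k n).
Hypothesis chainI : sym_invariant_chain I.

(** Invariance of the chain enters here: the image of x^A under inclusion and [s] is in [I n] and
    divides x^B. *)
Lemma nonface_transport (m n : nat) (le_mn : (m <= n)%N) (s : 'S_n)
    (A : {set 'I_(c * m)}) (B : {set 'I_(c * n)}) :
  (0 < m)%N ->
  (forall j, column A j \subset column B (s (widen_ord le_mn j))) ->
  I m (set_monomial A) -> I n (set_monomial B).
Proof.
move=> m0 AB IA; have [idI symI] := chainI.
have := symI m n le_mn m0 _ s IA; rewrite /sym_act /Defs.incl.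
rewrite !rename_set_monomial; first last.
- by move=> i j /(congr1 val) /= /val_inj.
- exact: perm_inj.
apply: ideal_monomial_sub; first by apply: idI; exact: (leq_trans m0 le_mn).
apply/fintype.subsetP => _ /imsetP[_ /imsetP[v vA ->] ->]; rewrite push_comp.
by have := fintype.subsetP (AB (var_index v).2) (var_index v).1; rewrite in_column => /(_ vA); rewrite inE.
Qed.

(** One witness suffices: [n] is forced to be the sum of [m], and any two sets with type vector [m]
    are related by a permutation. *)
Definition nonface_vector (m : seq nat) : Prop :=
  exists n, exists A : {set 'I_(c * n)},
    [/\ (0 < n)%N, type_vector (columns A) = m & I n (set_monomial A)].

Lemma nonface_vectorE (n : nat) (A : {set 'I_(c * n)}) : (0 < n)%N ->
  I n (set_monomial A) <-> nonface_vector (type_vector (columns A)).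
Proof.
move=> n0; split=> [IA|[m [B [m0 e IB]]]]; first by exists n, A.
have mn : m = n by rewrite -[m](size_tuple (columns B)) -sumn_type_vector e sumn_type_vector size_tuple.
subst m; move/eq_type_vector/perm_eq_columns: e => [s e].
apply: (@nonface_transport n n (leqnn n) s B) => // j.
by have -> : widen_ord (leqnn n) j = j; [exact: val_inj | rewrite e fintype.subxx].
Qed.

Lemma nonface_vector_up (m m' : seq nat) :
  size m = #|{set 'I_c}| -> size m' = #|{set 'I_c}| ->
  (forall i, (nth 0 m i <= nth 0 m' i)%N) -> nonface_vector m -> nonface_vector m'.
Proof.
move=> sm sm' le_m [n [A [n0 Am IA]]].
(* The numbers of columns of each type to append after those of [A]. *)
pose diff := [seq (nth 0 m' i - nth 0 m i)%N | i <- iota 0 #|{set 'I_c}|].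
have [W Wm] : exists W : seq {set 'I_c}, type_vector W = diff.
  by apply: type_vector_surj; rewrite size_map size_iota.
have AWm : type_vector (columns A ++ W) = m'.
  apply: (@eq_from_nth _ 0%N) => [|i]; rewrite size_type_vector // => id.
  rewrite nth_type_vector_cat Am Wm (nth_map 0%N) ?size_iota // nth_iota // add0n.
  by rewrite subnKC.
pose n' := size (columns A ++ W).
have [B BE] := columns_surj n' (in_tuple (columns A ++ W)).
have le_n : (n <= n')%N by rewrite /n' size_cat size_tuple leq_addr.
exists n', B; split; first exact: (leq_trans n0 le_n).
  by rewrite BE.
apply: (@nonface_transport n n' le_n 1%g A) => // j; rewrite perm1.
have <- : tnth (columns B) (widen_ord le_n j) = column B (widen_ord le_n j).
  by rewrite tnth_mktuple.
rewrite BE (tnth_nth finset.set0) nth_cat size_tuple (ltn_ord j) -tnth_nth tnth_mktuple.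
exact: fintype.subxx.
Qed.

(** Adding a variable in row [i] turns a column [T] into [i |: T]; the positivity condition
    restricts to types that occur. *)
Definition facet_vector (m : seq nat) : Prop :=
  ~ nonface_vector m /\
  forall (T : {set 'I_c}) i, i \notin T ->
    (0 < nth 0 m (index T (enum {set 'I_c})))%N ->
    nonface_vector (move_unit m (index T (enum {set 'I_c}))
                                (index (i |: T) (enum {set 'I_c}))).

Lemma facet_vectorE (n : nat) (F : {set 'I_(c * n)}) : (0 < n)%N ->
  facet (I n) F <-> facet_vector (type_vector (columns F)).
Proof.
move=> n0; rewrite /facet /facet_vector nonface_vectorE //; split=> -[nF Fmax]; split=> //.
  move=> T i iT; rewrite nth_type_vector -has_count => /hasP[_ /mapP[j _ ->] /eqP jT].
  have := Fmax (mxvec_index i j); rewrite nonface_vectorE //.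
  have vF : mxvec_index i j \notin F by move: iT; rewrite -jT inE.
  by move=> /(_ vF); rewrite type_vector_add // mxvec_indexK /= jT.
move=> v vF; rewrite nonface_vectorE // type_vector_add //; apply: Fmax.
  by rewrite in_column.
rewrite nth_type_vector -has_count; apply/hasP; exists (column F (var_index v).2) => //=.
by apply/mapP; exists (var_index v).2; rewrite ?mem_enum.
Qed.

Lemma facet_vector_trunc : exists K, forall m m',
  size m = #|{set 'I_c}| -> size m' = #|{set 'I_c}| -> eq_trunc K m m' ->
  facet_vector m -> facet_vector m'.
Proof.
have [K UK] := @upset_eq_trunc #|{set 'I_c}| nonface_vector nonface_vector_up.
have ltd (T : {set 'I_c}) : (index T (enum {set 'I_c}) < #|{set 'I_c}|)%N.
  by rewrite cardT index_mem mem_enum.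
(* A unit move lowers an entry by one, so agreement up to [K.+1] leaves agreement up to [K]; it also
   detects whether an entry is positive. *)
exists K.+1 => m m' sm sm' h [nU Umax]; split.
  move=> /UK U; apply: nU; apply: U => // i; have := h i; lia.
move=> T i iT m0; apply: (UK _ _ _ _ _ (Umax T i iT _)); rewrite ?size_move_unit ?sm ?sm' ?ltd //.
  by move=> j; rewrite !nth_move_unit; have := h j; lia.
by have := h (index T (enum {set 'I_c})); lia.
Qed.

End Chain.

(** * Counting orbits by facet vectors *)

Lemma card_set_seq (T : choiceType) (s : seq T) : uniq s -> [set` s] #= `I_(size s).
Proof.
case: s => [_|x s us].
  by rewrite II0 card_eq0; apply/eqP/seteqP; split.
have -> : [set` x :: s] = nth x (x :: s) @` `I_(size (x :: s)).
  apply/seteqP; split=> [y /= ys|_ [i /= id <-]]; last exact: mem_nth.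
  by exists (index y (x :: s)); [rewrite -index_mem in ys | exact: nth_index].
apply: inj_card_eq => i j; rewrite !inE /= => id jd /eqP.
by rewrite nth_uniq // => /eqP.
Qed.

Theorem corollary1p3 (c : nat) (hc : (0 < c)%N) (k : fieldType)
    (I : forall n : nat, set (Rn c k n))
    (hchain : sym_invariant_chain I)
    (hsqf : forall n : nat, (0 < n)%N -> squarefree_monomial_ideal (I n)) :
  exists (p : {poly rat}) (N : nat),
    forall n : nat, (N <= n)%N ->
      exists r : nat, component_orbits (I n) #= `I_r /\ r%:R = p.[n%:R].
Proof.
pose d := #|{set 'I_c}|.
pose P m := `[< facet_vector I m >].
have [K PK] := facet_vector_trunc I hchain.
have [p [N hp]] : eventually_poly (fun n => count P (weak_compositions d n)).
  apply: (@count_eventually_poly d K) => m m' sm sm' h.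
  by apply/asboolP/asboolP; apply: PK => // i; rewrite h.
(* The successor excludes [n = 0], where the chain is unconstrained. *)
exists p, N.+1 => n Nn; have n0 : (0 < n)%N by lia.
exists (count P (weak_compositions d n)); split; last by apply: hp; lia.
pose orbit_of m : set (set (Rn c k n)) :=
  [set face_prime G | G in [set G | type_vector (columns G) = m]].
have vecP m : m \in weak_compositions d n ->
    exists F : {set 'I_(c * n)}, type_vector (columns F) = m.
  rewrite mem_weak_compositions => /andP[/eqP sm /eqP summ].
  have [ts tsm] := @type_vector_surj c m sm.
  have sz : size ts == n by rewrite -sumn_type_vector tsm summ.
  by have [F FE] := columns_surj n (Tuple sz); exists F; rewrite FE.
(* Orbits of components are indexed by the facet vectors of sum [n]. *)
have -> : component_orbits (I n) = orbit_of @` [set` filter P (weak_compositions d n)].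
  have [S [sqfS IE]] := hsqf n n0; have idI := hchain.1 n n0.
  rewrite /component_orbits (primary_componentsE S) // image_comp.
  apply/seteqP; split=> [_ [F Ff <-]|_ [m /= + <-]].
    exists (type_vector (columns F)); last by rewrite /= sym_orbit_face_prime.
    rewrite /= mem_filter mem_weak_compositions size_type_vector sumn_type_vector.
    apply/and3P; split; rewrite ?size_tuple ?card_ord //.
    by apply/asboolP/facet_vectorE.
  rewrite mem_filter => /andP[/asboolP Pm /vecP[F Fm]]; exists F.
    by apply/facet_vectorE => //; rewrite Fm.
  by rewrite /= sym_orbit_face_prime Fm.
rewrite -size_filter; apply: card_eq_trans (card_set_seq _ _ _); last first.
  by rewrite filter_uniq // weak_compositions_uniq.
(* Distinct vectors give distinct orbits: a prime P_F in both determines [F], hence its type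
   vector. *)
apply: inj_card_eq => m m'; rewrite !inE /= !mem_filter => /andP[_ /vecP[F Fm]] _ e.
have : orbit_of m (face_prime F) by exists F.
by rewrite e => -[G Gm' /face_prime_inj GF]; rewrite -Fm -Gm' GF.
Qed.
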